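(* Let $X_1,\dots,X_n$ be i.i.d. random variables with values in a metric space $(\mathcal X,d)$, let $\Theta\subseteq\mathbb R$ be an interval, let $p(x,\theta)$ be a density and $l(x,\theta)=-\log p(x,\theta)$, where for every $x\in\mathcal X$ the map $\theta\mapsto l(x,\theta)$ is three times continuously differentiable on $\Theta$. Let the MLE $$\widehat\theta=\arg\min_{\theta\in\Theta}\Big[\frac1n\sum_{i=1}^n l(X_i,\theta)\Big]=f(X_1,\dots,X_n)$$ be a function of the data. Assume that there are constants $c_H>0$ and $c_l>0$ such that $$\inf_{\theta\in\Theta}\ddot l(x,\theta)\ge c_H\quad\text{for all }x\in\mathcal X,$$ $$|\dot l(x,\theta)-\dot l(y,\theta)|\le c_l\,d(x,y)\quad\text{for all }\theta\in\Theta,\ x,y\in\mathcal X.$$ Let $(Y_1,\dots,Y_n)$ be an independent copy of $(X_1,\dots,X_n)$. (a) If $\|d(X_k,Y_k)\|_{\theta_2}<\infty$ for all $k$, then $$\widehat\theta-\mathrm E\widehat\theta\sim\operatorname{subG}\Big(\frac{16c_l^2}{c_H^2n^2}\sum_{k=1}^n\|d(X_k,Y_k)\|_{\theta_2}^2\Big),$$ and for all $t\ge0$ $$\mathrm P\{|\widehat\theta-\mathrm E\widehat\theta|>t\}\le 2\exp\left(\frac{-t^2}{\frac{16c_l^2}{c_H^2n^2}\sum_{k=1}^n\|d(X_k,Y_k)\|_{\theta_2}^2}\right).$$ (b) If $\|d(X_k,Y_k)\|_{\theta_1}<\infty$ for all $k$, then $$\widehat\theta-\mathrm E\widehat\theta\sim\operatorname{sub}\Gamma\Big(\frac{2c_l^2}{c_H^2n^2}\sum_{k=1}^n\|d(X_k,Y_k)\|_{\theta_1}^2,\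 \frac{c_l}{c_Hn}\max_{1\le k\le n}\|d(X_k,Y_k)\|_{\theta_1}\Big),$$ and for all $t\ge0$ $$\mathrm P\{|\widehat\theta-\mathrm E\widehat\theta|>t\}\le 2\exp\left(\frac{-t^2}{\frac{4c_l^2}{c_H^2n^2}\sum_{k=1}^n\|d(X_k,Y_k)\|_{\theta_1}^2+\frac{2c_l}{c_Hn}\max_{1\le k\le n}\|d(X_k,Y_k)\|_{\theta_1}\,t}\right).$$
   Context: $\dot l,\ddot l$ denote the first and second partial derivatives of $l(x,\theta)$ with respect to $\theta$. For a real random variable $W$ define (suprema over integers $p\ge1$) $\|W\|_{\theta_1}=\sup_{p\ge1}\left(\frac{\mathrm E|W|^p}{p!}\right)^{1/p}$ and $\|W\|_{\theta_2}=\sup_{p\ge1}\left[\frac{\mathrm E W^{2p}}{(2p-1)!!}\right]^{1/(2p)}$; these are applied also to non-centered variables such as $d(X_k,Y_k)$. A centered random variable $W$ satisfies $W\sim\operatorname{subG}(\sigma^2)$ if $\mathrm E e^{sW}\le e^{s^2\sigma^2/2}$ for all $s\in\mathbb R$. A centered random variable $W$ satisfies $W\sim\operatorname{sub}\Gamma(\eta,M)$ if $\log\mathrm E e^{sW}\le\frac{\eta s^2}{2(1-M|s|)}$ for all $0<|s|<M^{-1}$. *)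

(* Defs.v *)
From HB Require Import structures.
From mathcomp Require Import all_boot all_order all_algebra.
From mathcomp Require Import all_classical all_reals all_analysis.
Set Implicit Arguments.
Unset Strict Implicit.
Unset Printing Implicit Defensive.
Import Order.TTheory GRing.Theory Num.Theory.
Import numFieldNormedType.Exports.
Local Open Scope classical_set_scope.
Local Open Scope ring_scope.

(* Measurable types are pointed in the library. A space that carries a random
   variable is nonempty, so asking for a point costs no generality. *)
#[short(type="pmetricType")]
HB.structure Definition PointedMetric (R : numDomainType) :=
  {T of Pointed T & Metric R T}.

Notation borel T := (g_sigma_algebraType (@open T)).

Section derivatives.
Context {R : realType}.
Implicit Types (D : set R) (g : R -> R).

(* Derivatives are relative to D: at an endpoint of an interval D that belongs
   to D they are one-sided. *)
Definition diff_quotient g (t : R) : R -> R :=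
  fun s => (s - t)^-1 * (g s - g t).

Definition derivable_on D g :=
  forall t, D t -> cvg (diff_quotient g t @ within D t^').

Definition derive_on D g : R -> R :=
  fun t => lim (diff_quotient g t @ within D t^').

Definition deriven_on D k g : R -> R := iter k (derive_on D) g.

Definition continuously_derivable_on D m g :=
  (forall k, (k < m)%N -> derivable_on D (deriven_on D k g)) /\
  (forall k, (k <= m)%N -> {within D, continuous (deriven_on D k g)}).

Definition is_argmin D g (t : R) := D t /\ forall s, D s -> g t <= g s.

End derivatives.

Section laws.
Context {R : realType} {d : measure_display} {Omega : measurableType d}.
Variable P : probability Omega R.

Definition same_law {d' : measure_display} {U : measurableType d'}
    (Y Z : Omega -> U) :=
  forall A, measurable A -> P (Y @^-1` A) = P (Z @^-1` A).

Definition independent {d' : measure_display} {U : measurableType d'}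
    (Y Z : Omega -> U) :=
  forall A B, measurable A -> measurable B ->
    P (Y @^-1` A `&` Z @^-1` B) = (P (Y @^-1` A) * P (Z @^-1` B))%E.

Definition mutually_independent {d' : measure_display} {U : measurableType d'}
    {n : nat} (X : 'I_n -> Omega -> U) :=
  forall (J : {set 'I_n}) (A : 'I_n -> set U), (forall k, measurable (A k)) ->
    P (\bigcap_(k in [set` J]) X k @^-1` A k) =
    (\prod_(k in J) P (X k @^-1` A k))%E.

Definition iid {d' : measure_display} {U : measurableType d'}
    {n : nat} (X : 'I_n -> Omega -> U) :=
  mutually_independent X /\ forall i j, same_law (X i) (X j).

Definition sample {U : Type} {n : nat} (X : 'I_n -> Omega -> U) :
    Omega -> n.-tuple U :=
  fun w => [tuple X k w | k < n].

Definition independent_copy {d' : measure_display} {U : measurableType d'}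
    {n : nat} (X Y : 'I_n -> Omega -> U) :=
  same_law (sample Y) (sample X) /\ independent (sample X) (sample Y).

Definition norm_theta1 (W : Omega -> R) : \bar R :=
  ereal_sup [set (('E_P[(fun w => `|W w| ^+ p)%R] / (p`!%:R)%:E) `^ (p%:R^-1))%E
            | p in [set p : nat | (1 <= p)%N]].

(* (2 p - 1)!! *)
Definition odd_dfact (p : nat) : nat := (\prod_(i < p) (i.*2.+1))%N.

Definition norm_theta2 (W : Omega -> R) : \bar R :=
  ereal_sup [set (('E_P[(fun w => W w ^+ p.*2)%R] / ((odd_dfact p)%:R)%:E)
                    `^ (p.*2%:R^-1))%E
            | p in [set p : nat | (1 <= p)%N]].

Definition centered (W : Omega -> R) :=
  P.-integrable setT (EFin \o W) /\ ('E_P[W] = 0)%E.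

Definition subG (W : Omega -> R) (sigma2 : R) :=
  centered W /\
  forall s : R, ('M_P W s <= (expR (s ^+ 2 * sigma2 / 2))%:E)%E.

(* The extended inverse gives 0^-1 = +oo: for M = 0 every s <> 0 is allowed. *)
Definition subGamma (W : Omega -> R) (eta M : R) :=
  centered W /\
  forall s : R, 0 < `|s| -> (`|s|%:E < (M%:E)^-1)%E ->
    (lne ('M_P W s) <= (eta * s ^+ 2 / (2 * (1 - M * `|s|)))%:E)%E.

End laws.

(* Positivity of p makes -log p finite, as its differentiability in theta
   requires; the library's ln is 0 on nonpositive reals. *)
Definition positive_density {R : realType} {d : measure_display}
    {U : measurableType d} (nu : {measure set U -> \bar R}) (q : U -> R) :=
  [/\ measurable_fun setT q, (forall x, 0 < q x)
    & (\int[nu]_x (q x)%:E = 1)%E].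

Definition neg_log {R : realType} {U : Type} (p : U -> R -> R) : U -> R -> R :=
  fun x theta => - ln (p x theta).

(* Main.v *)
Require Import Defs.
From HB Require Import structures.
From mathcomp Require Import all_boot all_order all_algebra.
From mathcomp Require Import all_classical all_reals all_analysis.
From mathcomp Require Import measurable_realfun ring lra.
Set Implicit Arguments.
Unset Strict Implicit.
Unset Printing Implicit Defensive.
Import Order.TTheory GRing.Theory Num.Theory.
Import numFieldNormedType.Exports.
Local Open Scope classical_set_scope.
Local Open Scope ring_scope.

(** The estimator is a function of bounded differences in the metric, and the
    bounded-differences (McDiarmid) martingale argument works with moments of
    d(X_k, Y_k) in place of a uniform bound on d.

    Stability of the minimizer ([mle_bounded_differences]).  Let x and y differ
    in coordinate k only and let a = f x < b = f y.  Minimality of a for x makes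
    the derivative of the empirical loss of x nonnegative at a (in the direction
    of b), minimality of b for y makes that of y nonpositive at b.  By the mean
    value theorem the derivative of the loss of x grows by at least cH (b - a)
    from a to b, so the two losses have derivatives at b that differ by at least
    cH (b - a); by the Lipschitz hypothesis they differ by at most
    cl d(x_k, y_k) / n.  Hence |f x - f y| <= c d(x_k, y_k) with
    c = cl / (cH n).

    One coordinate ([mgf_bounded_symmetrization]).  If Z' is an independent copy
    of Z then E e^(s Z) E e^(- s Z) = E e^(s (Z - Z')) is even in s, hence equal
    to E cosh (s (Z - Z')).  By Jensen's inequality
    E e^(s (Z - E Z)) <= E e^(s Z) E e^(- s Z).  For Z = g (X_k) and
    Z' = g (Y_k), with |g x - g y| <= c d(x, y), this is at most
    E cosh (s c d(X_k, Y_k)).  The two sides of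
    |g (X_k) - g (Y_k)| <= c d(X_k, Y_k) are compared on the sample space, which
    is what makes the argument valid when d is not measurable for the product of
    the two Borel sigma-algebras.

    All coordinates ([bounded_differences_mgf_bounded]).  The mean of f over all
    coordinates but the first again has difference c d(x, y) in the first one,
    so Tonelli's theorem and induction on n multiply the one-coordinate bounds.

    Moments.  The Taylor series of cosh turns bounds on even moments into a
    bound on E cosh (u d(X_k, Y_k)): with N the theta_2 norm,
    E d^(2p) <= (2p - 1)!! N^(2p) and (2p)! = (2p - 1)!! 2^p p! sum to
    e^(u^2 N^2 / 2); with N the theta_1 norm, E d^(2p) <= (2p)! N^(2p) sums to
    1 / (1 - u^2 N^2) <= e^(u^2 N^2 / (1 - |u| N)).

    Tails ([bernstein_tail]) follow from Chernoff's bound.  In part (a) the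
    moment generating function is bounded with a sixteenth of the stated
    variance proxy; this room pays for the factor 2 that separates
    exp (- t^2 / v) from the tail exp (- t^2 / (2 v)) of subG(v). *)

(** * Derivatives relative to an interval, and stability of minimizers *)

Section relative_derivative.
Context {R : realType}.
Implicit Types (D : set R) (g : R -> R).

Lemma derive_on_cvg D g t :
  derivable_on D g -> D t ->
  diff_quotient g t x @[x --> within D t^'] --> derive_on D g t.
Proof. by move=> dg Dt; exact: dg. Qed.

(** First-order condition at a constrained minimizer t: the slope in the
    direction of any other point s of the interval is nonnegative.  The two
    one-sided conditions become one by multiplying with s - t. *)
Lemma diff_quotient_lim_argmin D g (t s L : R) : is_interval D -> is_argmin D g t ->
  D s -> diff_quotient g t x @[x --> within D t^'] --> L -> 0 <= L * (s - t).
Proof.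
move=> Ditv [Dt gmin] Ds /cvgrPdist_lt hL; rewrite leNgt; apply/negP => L0.
have st : s - t != 0 by apply: contraTneq L0 => ->; rewrite mulr0 ltxx.
have nL0 : 0 < `|L| by rewrite normr_gt0; apply: contraTneq L0 => ->; rewrite mul0r ltxx.
have [r /= r0 rA] := hL _ nL0.
(* Move from t towards s by a fraction eta of the way: at most 1, to stay in the
   interval D, and small enough to come within distance r of t. *)
pose eta := Num.min 1 (r / 2 / `|s - t|).
have eta0 : 0 < eta by rewrite lt_min ltr01 !divr_gt0// normr_gt0.
have eta1 : eta <= 1 by rewrite ge_min lexx.
pose x := t + eta * (s - t).
have xt : x - t = eta * (s - t) by rewrite /x addrAC subrr add0r.
have Dx : D x.
  have [ts|ts] := leP t s.
    by apply: (Ditv t s) => //; apply/andP; split; rewrite /x; nra.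
  by apply: (Ditv s t) => //; apply/andP; split; rewrite /x; nra.
have xr : `|t - x| < r.
  rewrite distrC xt normrM (gtr0_norm eta0) -ltr_pdivlMr ?normr_gt0//.
  rewrite gt_min; apply/orP; right; rewrite ltr_pM2r ?invr_gt0 ?normr_gt0//.
  by rewrite ltr_pdivrMr// ltr_pMr// ltr1n.
have xNt : x != t by rewrite -subr_eq0 xt mulf_neq0// gt_eqF.
have := rA x xr xNt Dx; set q := diff_quotient g t x => qL.
have : 0 <= q * (s - t).
  rewrite /q /diff_quotient xt.
  have -> : (eta * (s - t))^-1 * (g x - g t) * (s - t) = eta^-1 * (g x - g t).
    by field; rewrite st gt_eqF.
  by rewrite mulr_ge0 ?invr_ge0 ?(ltW eta0)// subr_ge0 gmin.
have : (q - L) * (s - t) < `|L| * `|s - t|.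
  apply: le_lt_trans (ler_norm _) _; rewrite normrM distrC.
  by rewrite ltr_pM2r ?normr_gt0.
by rewrite -normrM (ltr0_norm L0) mulrBl; lra.
Qed.

(** Strictly between two points of D, the filter of D around t is the full
    punctured neighborhood filter; the mean value theorem needs this two-sided
    derivative. *)
Lemma derive_on_is_derive D g a b t : is_interval D -> derivable_on D g ->
  D a -> D b -> a < t < b -> is_derive t 1 g (derive_on D g t).
Proof.
move=> Ditv dg Da Db /andP[at_ tb].
have Dt : D t by apply: (Ditv a b) => //; rewrite !ltW.
have h : (fun h => h^-1 *: (g (h *: 1 + t) - g t)) x @[x --> 0^'] --> derive_on D g t.
  apply/cvgrPdist_lt => e e0.
  have /cvgrPdist_lt /(_ e e0) := derive_on_cvg dg Dt.
  rewrite /= => -[r /= r0 rA].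
  exists (Num.min r (Num.min (t - a) (b - t))) => /=.
    by rewrite !lt_min r0 !subr_gt0 at_ tb.
  move=> x /=; rewrite sub0r normrN !lt_min => /andP[xr /andP[xa xb]] x0.
  have := rA (x + t); rewrite /= /diff_quotient addrK.
  rewrite opprD addrCA subrr addr0 normrN => /(_ xr).
  rewrite scaler1; apply.
    by rewrite -subr_eq0 addrK.
  apply: (Ditv a b) => //; move: xa xb; rewrite !ltr_norml => /andP[xa _] /andP[_ xb].
  by apply/andP; split; lra.
by apply: DeriveDef; [exact: cvgP h|exact: cvg_lim h].
Qed.

Lemma derive_on_growth D g a b c : is_interval D -> derivable_on D g ->
  {within D, continuous g} -> D a -> D b -> a < b ->
  (forall t, D t -> c <= derive_on D g t) ->
  c * (b - a) <= g b - g a.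
Proof.
move=> Ditv dg cg Da Db ab hc.
have sub : `[a, b] `<=` D.
  by move=> x /=; rewrite in_itv /= => xab; exact: (Ditv a b).
have [|x xab ->] := MVT ab (f := g) (df := derive_on D g) _
   (continuous_subspaceW sub cg).
  by move=> x; rewrite in_itv /=; exact: derive_on_is_derive.
apply: ler_wpM2r; first by rewrite subr_ge0 ltW.
apply: hc; apply: sub.
by move: xab; rewrite /= !in_itv /= => /andP[? ?]; rewrite !ltW.
Qed.

Lemma diff_quotient_mean n (l : 'I_n -> R -> R) t s :
  diff_quotient (fun x => n%:R^-1 * \sum_(k < n) l k x) t s =
  n%:R^-1 * \sum_(k < n) diff_quotient (l k) t s.
Proof.
by rewrite /diff_quotient -mulr_sumr -mulrBr sumrB mulrCA.
Qed.

Lemma derive_on_mean_cvg D n (l : 'I_n -> R -> R) t :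
  (forall k, derivable_on D (l k)) -> D t ->
  diff_quotient (fun x => n%:R^-1 * \sum_(k < n) l k x) t x @[x --> within D t^']
    --> n%:R^-1 * \sum_(k < n) derive_on D (l k) t.
Proof.
move=> dl Dt; under eq_fun do rewrite diff_quotient_mean.
apply: cvgM; first exact: cvg_cst.
elim: n => [|n IH] in l dl *.
  by rewrite big_ord0; under eq_fun do rewrite big_ord0; exact: cvg_cst.
rewrite big_ord_recr/=; under eq_fun do rewrite big_ord_recr/=.
by apply: cvgD; [exact: IH|exact: derive_on_cvg].
Qed.

(** Both first-order conditions concern the derivative at different points; the
    convexity bound c transports the one for l from a to b, where it meets the
    one for l'. *)
Lemma argmin_mean_perturbation D n (l l' : 'I_n -> R -> R) (c e : R) (a b : R) :
  (0 < n)%N -> is_interval D ->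
  (forall k, derivable_on D (l k)) -> (forall k, derivable_on D (l' k)) ->
  (forall k, derivable_on D (derive_on D (l k))) ->
  (forall k, {within D, continuous (derive_on D (l k))}) ->
  (forall k t, D t -> c <= derive_on D (derive_on D (l k)) t) ->
  (forall t, D t -> \sum_(k < n) (derive_on D (l k) t - derive_on D (l' k) t) <= e) ->
  is_argmin D (fun x => n%:R^-1 * \sum_(k < n) l k x) a ->
  is_argmin D (fun x => n%:R^-1 * \sum_(k < n) l' k x) b ->
  a < b -> c * n%:R * (b - a) <= e.
Proof.
move=> n0 Ditv dl dl' ddl cdl hc he amin bmin ab.
have [[Da _] [Db _]] := (amin, bmin).
have La := diff_quotient_lim_argmin Ditv amin Db (derive_on_mean_cvg dl Da).
have Lb := diff_quotient_lim_argmin Ditv bmin Da (derive_on_mean_cvg dl' Db).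
have n0' : 0 < n%:R :> R by rewrite ltr0n.
have {}La : 0 <= \sum_(k < n) derive_on D (l k) a.
  by move: La; rewrite pmulr_lge0 ?subr_gt0// pmulr_rge0// invr_gt0.
have {}Lb : \sum_(k < n) derive_on D (l' k) b <= 0.
  by move: Lb; rewrite nmulr_lge0 ?subr_lt0// pmulr_rle0// invr_gt0.
have grow : c * n%:R * (b - a) <=
    \sum_(k < n) (derive_on D (l k) b - derive_on D (l k) a).
  have -> : c * n%:R * (b - a) = \sum_(k < n) (c * (b - a)).
    by rewrite sumr_const card_ord -[RHS]mulr_natr; ring.
  apply: ler_sum => k _; apply: (derive_on_growth Ditv) => //; exact: hc.
have := he b Db; rewrite !sumrB in grow *; lra.
Qed.

End relative_derivative.

Lemma mle_bounded_differences {R : realType} {T : pmetricType R} (n : nat)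
    (Theta : set R) (l : T -> R -> R) (f : n.-tuple T -> R) (cH cl : R) :
  (0 < n)%N -> is_interval Theta ->
  (forall x, continuously_derivable_on Theta 3 (l x)) ->
  (forall x : n.-tuple T, is_argmin Theta
     (fun theta => n%:R^-1 * \sum_(k < n) l (tnth x k) theta) (f x)) ->
  0 < cH -> 0 < cl ->
  (forall x, (cH%:E <=
      ereal_inf [set (deriven_on Theta 2 (l x) theta)%:E | theta in Theta])%E) ->
  (forall theta, Theta theta -> forall x y : T,
     `|derive_on Theta (l x) theta - derive_on Theta (l y) theta| <= cl * mdist x y) ->
  forall (x y : n.-tuple T) k, (forall j, j != k -> tnth x j = tnth y j) ->
    `|f x - f y| <= cl / (cH * n%:R) * mdist (tnth x k) (tnth y k).
Proof.
move=> n_gt0 Theta_itv l_C3 f_mle cH_gt0 cl_gt0 l_convex l_lip.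
have n0 : 0 < n%:R :> R by rewrite ltr0n.
have cHn : 0 < cH * n%:R by rewrite mulr_gt0.
have ordered (x y : n.-tuple T) k : (forall j, j != k -> tnth x j = tnth y j) ->
    f x < f y -> f y - f x <= cl / (cH * n%:R) * mdist (tnth x k) (tnth y k).
  move=> xy fxy; rewrite mulrAC ler_pdivlMr// mulrC.
  apply: (argmin_mean_perturbation n_gt0 Theta_itv _ _ _ _ _ _ (f_mle x) (f_mle y) fxy).
  - by move=> j; have [h _] := l_C3 (tnth x j); exact: (h 0%N).
  - by move=> j; have [h _] := l_C3 (tnth y j); exact: (h 0%N).
  - by move=> j; have [h _] := l_C3 (tnth x j); exact: (h 1%N).
  - by move=> j; have [_ h] := l_C3 (tnth x j); exact: (h 1%N).
  - move=> j t Dt; rewrite -lee_fin; apply: le_trans (l_convex (tnth x j)) _.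
    by apply: ereal_inf_lbound; exists t.
  - move=> t Dt; rewrite (bigD1 k)//= big1 ?addr0.
      by apply: le_trans (l_lip t Dt _ _); exact: ler_norm.
    by move=> j jk; rewrite xy// subrr.
move=> x y k xy; case: (ltgtP (f x) (f y)) => fxy.
- by rewrite distrC gtr0_norm ?subr_gt0//; apply: ordered.
- rewrite gtr0_norm ?subr_gt0// metric_sym; apply: ordered => // j jk.
  by rewrite xy.
- by rewrite fxy subrr normr0 mulr_ge0 ?mdist_ge0// divr_ge0// ltW.
Qed.

(** * Tonelli and Fubini for independent variables *)

(** Independence of variables with different value types, such as one coordinate
    of a sample and the tuple of the others. *)
Definition independent_pair {R : realType} {d d1 d2 : measure_display}
    {Omega : measurableType d} {A : measurableType d1} {B : measurableType d2}
    (P : probability Omega R) (U : Omega -> A) (V : Omega -> B) :=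
  forall S T, measurable S -> measurable T ->
    P (U @^-1` S `&` V @^-1` T) = (P (U @^-1` S) * P (V @^-1` T))%E.

Section independence.
Local Open Scope ereal_scope.
Context {R : realType} {d d1 d2 : measure_display} {Omega : measurableType d}
  {A : measurableType d1} {B : measurableType d2} (P : probability Omega R)
  (U : Omega -> A) (V : Omega -> B) (mU : measurable_fun setT U)
  (mV : measurable_fun setT V) (UV : independent_pair P U V).

Let U' : {mfun Omega >-> A} := HB.pack U (isMeasurableFun.Build _ _ _ _ _ mU).
Let V' : {mfun Omega >-> B} := HB.pack V (isMeasurableFun.Build _ _ _ _ _ mV).
Let mW : measurable_fun setT (fun w => (U w, V w)).
Proof. exact/measurable_fun_pair. Qed.
Let W' : {mfun Omega >-> (A * B)%type} :=
  HB.pack (fun w => (U w, V w)) (isMeasurableFun.Build _ _ _ _ _ mW).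

Let joint_law (S : set (A * B)) : measurable S ->
  (distribution P U' \x distribution P V') S = distribution P W' S.
Proof.
by move=> mS; apply: product_measure_unique.
Qed.

(** Tonelli on the law of (U, V), written on the sample space: the joint law is
    the product of the laws because they agree on rectangles. *)
Lemma ge0_integral_independent (F : A * B -> \bar R) :
  measurable_fun setT F -> (forall z, 0 <= F z) ->
  \int[P]_w F (U w, V w) = \int[P]_w \int[P]_w' F (U w, V w').
Proof.
move=> mF F0.
have -> : \int[P]_w F (U w, V w) = \int[distribution P W']_z F z.
  by rewrite ge0_integral_distribution.
rewrite (eq_measure_integral (distribution P U' \x distribution P V')%E);
  last by move=> S mS _; exact/esym/joint_law.
rewrite fubini_tonelli1// ge0_integral_distribution//; last 2 first.
- exact: measurable_fun_fubini_tonelli_F.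
- by move=> y; exact: integral_ge0.
apply: eq_integral => w _ /=; rewrite /fubini_F ge0_integral_distribution//.
by apply: measurableT_comp => //; exact: pair1_measurable.
Qed.

Lemma integral_independent (F : A * B -> \bar R) :
  measurable_fun setT F -> P.-integrable setT (fun w => F (U w, V w)) ->
  (forall a, P.-integrable setT (fun w => F (a, V w))) ->
  \int[P]_w F (U w, V w) = \int[P]_w \int[P]_w' F (U w, V w').
Proof.
move=> mF iF iFV.
have -> : \int[P]_w F (U w, V w) = \int[distribution P W']_z F z.
  by rewrite integral_distribution.
have iF' : (distribution P U' \x distribution P V').-integrable setT F.
  apply/integrableP; split => //.
  rewrite (eq_measure_integral (distribution P W')); last first.
    by move=> S mS _; exact: joint_law.
  rewrite ge0_integral_distribution//; last exact: measurableT_comp.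
  by case/integrableP : iF.
rewrite (eq_measure_integral (distribution P U' \x distribution P V')%E);
  last by move=> S mS _; exact/esym/joint_law.
rewrite -integral12_prod_meas1//.
have FE a : fubini_F (distribution P V') F a = \int[P]_w F (a, V w).
  rewrite /fubini_F integral_distribution//; last exact: iFV.
  by apply: measurableT_comp => //; exact: pair1_measurable.
rewrite integral_distribution.
- by apply: eq_integral => w _ /=; rewrite FE.
- exact: measurable_fubini_F iF'.
- have := integrable_fubini_F iF' => /integrableP[mG].
  rewrite ge0_integral_distribution//; last exact: measurableT_comp.
  by move=> iG; apply/integrableP; split => //; exact: measurableT_comp.
Qed.

End independence.

(** * Exponential moments and symmetrization *)

(** S is the range of admissible s.  Integrability is part of the notion since it
    is produced, together with the bound, by the induction on the number of
    coordinates. *)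
Definition mgf_bounded {R : realType} {d : measure_display}
    {Omega : measurableType d} (P : probability Omega R) (Z : Omega -> R)
    (S : set R) (b : R -> R) :=
  P.-integrable setT (EFin \o Z) /\
  forall s, S s ->
    (\int[P]_w (expR (s * (Z w - fine (\int[P]_w' (Z w')%:E))))%:E
       <= (expR (b s))%:E)%E.

Definition cosh {R : realType} (x : R) : R := (expR x + expR (- x)) / 2.

Lemma cosh_ge0 {R : realType} (x : R) : 0 <= cosh x.
Proof. by rewrite divr_ge0 ?addr_ge0 ?expR_ge0. Qed.

Lemma measurable_cosh {R : realType} : measurable_fun setT (@cosh R).
Proof.
apply: measurable_funM => //; apply: measurable_funD => //.
exact: measurableT_comp.
Qed.

Lemma cosh_le {R : realType} (x y : R) : `|x| <= `|y| -> cosh x <= cosh y.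
Proof.
have coshN (z : R) : cosh (`|z|) = cosh z.
  by case: (ger0P z) => // _; rewrite /cosh opprK addrC.
rewrite -(coshN x) -(coshN y); move: (normr_ge0 x); move: `|x| `|y| => {x y}x y x0 xy.
rewrite /cosh ler_wpM2r// -subr_ge0.
have ex : 1 <= expR x by rewrite -expR0 ler_expR.
have exy : expR x <= expR y by rewrite ler_expR.
have -> : expR y + expR (- y) - (expR x + expR (- x)) =
    (expR y - expR x) * (1 - (expR x * expR y)^-1).
  by rewrite !expRN; field; rewrite !gt_eqF ?expR_gt0.
rewrite mulr_ge0 ?subr_ge0// invf_le1 ?mulr_gt0 ?expR_gt0//.
by rewrite -[leLHS]mulr1 ler_pM// (le_trans ex).
Qed.

Lemma mule2_inj {R : realType} (x y : \bar R) : (2%:E * x = 2%:E * y -> x = y)%E.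
Proof.
move=> /(congr1 (fun z => (2^-1)%:E * z)%E).
by rewrite !muleA -EFinM mulVf// !mul1e.
Qed.

(** In extended reals 0 * +oo = 0, so a finite product does not bound its
    factors; a product at least 1 excludes this case. *)
Lemma mule_lty_l {R : realType} (x y : \bar R) :
  (0 <= x -> 0 <= y -> 1 <= x * y -> x * y < +oo -> x < +oo)%E.
Proof.
case: x => [x|//|//] x0; first by rewrite ltry.
rewrite le_eqVlt => /predU1P[<-|y0]; first by rewrite mule0 lee_fin ler10.
by rewrite gt0_mulye.
Qed.

Section exponential_moments.
Local Open Scope ereal_scope.
Context {R : realType} {d : measure_display} {Omega : measurableType d}
  (P : probability Omega R).

Lemma integral_probability_cst (c : \bar R) : \int[P]_w c = c.
Proof.
by rewrite -[LHS]/(\int[P]_w cst c w) integral_cst//= probability_setT mule1.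
Qed.

Lemma ge0_integral_same_law {d'} {U : measurableType d'} (Y Z : Omega -> U)
    (F : U -> \bar R) :
  measurable_fun setT Y -> measurable_fun setT Z -> same_law P Y Z ->
  measurable_fun setT F -> (forall u, 0 <= F u) ->
  \int[P]_w F (Y w) = \int[P]_w F (Z w).
Proof.
move=> mY mZ YZ mF F0.
pose Y' : {mfun Omega >-> U} := HB.pack Y (isMeasurableFun.Build _ _ _ _ _ mY).
pose Z' : {mfun Omega >-> U} := HB.pack Z (isMeasurableFun.Build _ _ _ _ _ mZ).
transitivity (\int[distribution P Y']_u F u).
  by rewrite ge0_integral_distribution.
transitivity (\int[distribution P Z']_u F u).
  by apply: eq_measure_integral => A mA _; exact: YZ.
by rewrite ge0_integral_distribution.
Qed.

Lemma measurable_expR_affine (Z : Omega -> R) (s m : R) :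
  measurable_fun setT Z ->
  measurable_fun setT (fun w => (expR (s * (Z w - m)))%:E).
Proof.
move=> mZ; apply/measurable_EFinP; apply: measurableT_comp => //.
by apply: measurable_funM => //; exact: measurable_funB.
Qed.

Lemma integral_expR_shift (Z : Omega -> R) (s m m' : R) :
  measurable_fun setT Z ->
  \int[P]_w (expR (s * (Z w - m)))%:E =
  (expR (s * (m' - m)))%:E * \int[P]_w (expR (s * (Z w - m')))%:E.
Proof.
move=> mZ; rewrite -ge0_integralZl//; last exact: measurable_expR_affine.
by apply: eq_integral => w _; rewrite -EFinM -expRD; congr (expR _)%:E; ring.
Qed.

(** Two exponential moments of opposite signs control |Z - m|, since
    |y| <= e^y + e^(- y). *)
Lemma integrable_expR_moments (Z : Omega -> R) (s m : R) :
  measurable_fun setT Z -> (0 < s)%R ->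
  \int[P]_w (expR (s * (Z w - m)))%:E < +oo ->
  \int[P]_w (expR (- s * (Z w - m)))%:E < +oo ->
  P.-integrable setT (EFin \o Z).
Proof.
move=> mZ s0 h1 h2.
have -> : EFin \o Z = (EFin \o (fun w => Z w - m)%R) \+ (EFin \o cst m).
  by apply/funext => w /=; rewrite -EFinD subrK.
apply: integrableD => //; last exact: finite_measure_integrable_cst.
have int e : \int[P]_w (expR (e * (Z w - m)))%:E < +oo ->
    P.-integrable setT (fun w => (expR (e * (Z w - m)))%:E).
  move=> h; apply/integrableP; split; first exact: measurable_expR_affine.
  under eq_integral do rewrite gee0_abs ?lee_fin ?expR_ge0//.
  by [].
apply: (@le_integrable _ _ _ P setT measurableT _
   (fun w => (s^-1)%:E * ((expR (s * (Z w - m)))%:E + (expR (- s * (Z w - m)))%:E))).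
- by apply/measurable_EFinP; exact: measurable_funB.
- move=> w _ /=; rewrite lee_fin.
  set y := (Z w - m)%R.
  rewrite [leRHS]ger0_norm; last first.
    by rewrite mulr_ge0 ?invr_ge0 ?addr_ge0 ?expR_ge0 ?ltW.
  rewrite ler_pdivlMl// -[X in (X * _)%R](gtr0_norm s0) -normrM.
  case: (leP 0%R (s * y)%R) => sy.
    rewrite ger0_norm//; have := expR_ge1Dx (s * y); have := expR_ge0 (- s * y).
    by lra.
  rewrite ltr0_norm//; have := expR_ge1Dx (- s * y); have := expR_ge0 (s * y).
  by lra.
- by apply: integrableZl => //; apply: integrableD => //; exact: int.
Qed.

Lemma integral_centered (Z : Omega -> R) :
  P.-integrable setT (EFin \o Z) ->
  \int[P]_w (Z w - fine (\int[P]_w' (Z w')%:E))%:E = 0.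
Proof.
move=> iZ; set m := fine _.
have -> : \int[P]_w (Z w - m)%:E = \int[P]_w ((EFin \o Z) \- (EFin \o cst m)) w.
  by apply: eq_integral.
rewrite integralB//; last exact: finite_measure_integrable_cst.
rewrite /= integral_probability_cst.
by rewrite fineK ?subee//; exact: integrable_fin_num.
Qed.

(** Jensen's inequality for the exponential: integrate 1 + y <= e^y, where
    y = s (Z - E Z) has mean 0. *)
Lemma integral_expR_centered_ge1 (Z : Omega -> R) (s : R) :
  P.-integrable setT (EFin \o Z) ->
  1 <= \int[P]_w (expR (s * (Z w - fine (\int[P]_w' (Z w')%:E))))%:E.
Proof.
move=> iZ; set m := fine _.
have mZ : measurable_fun setT Z.
  by apply/measurable_EFinP; exact: measurable_int iZ.
have [h|] := ltP (\int[P]_w (expR (s * (Z w - m)))%:E) +oo; last first.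
  by rewrite leye_eq => /eqP ->; rewrite leey.
have iZm : P.-integrable setT (EFin \o (fun w => Z w - m)%R).
  have -> : EFin \o (fun w => Z w - m)%R = (EFin \o Z) \- (EFin \o cst m).
    by apply/funext => w.
  by apply: integrableB => //; exact: finite_measure_integrable_cst.
have -> : 1 = \int[P]_w ((EFin \o cst 1%R) w + s%:E * (Z w - m)%:E).
  rewrite integralD//; last 2 first.
  - exact: finite_measure_integrable_cst.
  - exact: integrableZl.
  rewrite integralZl// integral_centered// mule0 adde0.
  by rewrite /= integral_probability_cst.
apply: le_integral => //.
- by apply: integrableD => //; [exact: finite_measure_integrable_cst|exact: integrableZl].
- apply/integrableP; split; first exact: measurable_expR_affine.
  by under eq_integral do rewrite gee0_abs ?lee_fin ?expR_ge0//.
- by move=> w _; rewrite /= lee_fin expR_ge1Dx.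
Qed.

(** With phi s = E e^(s Z), independence gives E e^(s (Z - Z')) = phi s phi (- s).
    This is even in s, so it is the mean of cosh (s (Z - Z')), and Jensen's
    inequality e^(- s E Z) <= phi (- s) bounds E e^(s (Z - E Z)) by it. *)
Lemma mgf_bounded_symmetrization (Z Z' : Omega -> R) (S : set R) (b : R -> R)
    (s0 : R) :
  measurable_fun setT Z -> measurable_fun setT Z' ->
  independent_pair P Z Z' -> same_law P Z Z' ->
  (0 < s0)%R -> S s0 ->
  (forall s, S s ->
     \int[P]_w (cosh (s * (Z w - Z' w)))%:E <= (expR (b s))%:E) ->
  mgf_bounded P Z S b.
Proof.
move=> mZ mZ' ind same s00 Ss0 hS.
pose phi s := \int[P]_w (expR (s * Z w))%:E.
have mexp s : measurable_fun setT (fun x : R => (expR (s * x))%:E).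
  by apply/measurable_EFinP; apply: measurableT_comp => //; exact: mulrl_measurable.
have prod s : \int[P]_w (expR (s * (Z w - Z' w)))%:E = phi s * phi (- s)%R.
  pose F (z : R * R) := (expR (s * z.1) * expR (- s * z.2))%:E.
  transitivity (\int[P]_w F (Z w, Z' w)).
    by apply: eq_integral => w _; rewrite /F/= -expRD; congr (expR _)%:E; ring.
  have mF : measurable_fun setT F.
    apply/measurable_EFinP; apply: measurable_funM; apply: measurableT_comp => //;
      exact: measurable_funM.
  rewrite (ge0_integral_independent mZ mZ' ind mF); last first.
    by move=> z; rewrite lee_fin mulr_ge0 ?expR_ge0.
  rewrite /F/=.
  rewrite /phi -ge0_integralZr//; last 2 first.
  - exact: (measurableT_comp (mexp s)).
  - by apply: integral_ge0.
  apply: eq_integral => w _; under eq_integral do rewrite EFinM.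
  rewrite ge0_integralZl//; last exact: (measurableT_comp (mexp (- s)%R)).
  congr (_ * _); apply/esym.
  apply: (ge0_integral_same_law mZ mZ' same (mexp (- s)%R)) => u.
  by rewrite lee_fin expR_ge0.
have mD : measurable_fun setT (fun w => Z w - Z' w)%R by exact: measurable_funB.
have coshE s : \int[P]_w (cosh (s * (Z w - Z' w)))%:E = phi s * phi (- s)%R.
  have E2 : 2%:E * \int[P]_w (cosh (s * (Z w - Z' w)))%:E =
     2%:E * (phi s * phi (- s)%R).
    rewrite -ge0_integralZl//; last 2 first.
    - apply/measurable_EFinP; apply: measurableT_comp measurable_cosh _.
      exact: measurable_funM.
    - by move=> w _; rewrite lee_fin cosh_ge0.
    transitivity (\int[P]_w ((expR (s * (Z w - Z' w)))%:E
                             + (expR (- s * (Z w - Z' w)))%:E)).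
      apply: eq_integral => w _; rewrite -EFinM -EFinD /cosh mulNr; congr _%:E.
      by field.
    rewrite ge0_integralD//; last 2 first.
    - exact: (measurableT_comp (mexp s)).
    - exact: (measurableT_comp (mexp (- s)%R)).
    by rewrite !prod opprK [phi (- s)%R * _]muleC mule_natl mule2n.
  exact: mule2_inj E2.
(* cosh >= 1, so neither factor vanishes; then finiteness of the product is
   finiteness of both factors. *)
have ge1 s : 1 <= phi s * phi (- s)%R.
  rewrite -coshE.
  rewrite -[leLHS](integral_probability_cst 1).
  apply: ge0_le_integral => //.
  - apply/measurable_EFinP; apply: measurableT_comp measurable_cosh _.
    exact: measurable_funM.
  - move=> w _; rewrite lee_fin ler_pdivlMr// mul1r.
    set y := (s * _)%R.
    by have := expR_ge1Dx y; have := expR_ge1Dx (- y); lra.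
have phi_ge0 s : 0 <= phi s.
  by apply: integral_ge0 => w _; rewrite lee_fin expR_ge0.
have phiphi_fin s : S s -> phi s * phi (- s)%R < +oo.
  by move=> Ss; rewrite -coshE; apply: le_lt_trans (hS s Ss) _; rewrite ltry.
have phi_fin s : S s -> phi s < +oo.
  by move=> Ss; apply: mule_lty_l (phiphi_fin _ Ss).
have phi_fin' s : S s -> phi (- s)%R < +oo.
  move=> Ss; apply: (@mule_lty_l _ _ (phi s)) => //; rewrite muleC//.
  exact: phiphi_fin.
have phiE s : phi s = \int[P]_w (expR (s * (Z w - 0)))%:E.
  by apply: eq_integral => w _; rewrite subr0.
have iZ : P.-integrable setT (EFin \o Z).
  apply: (@integrable_expR_moments Z s0 0%R) => //; rewrite -phiE.
    exact: phi_fin.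
  exact: phi_fin'.
split => // s Ss; set m := fine _.
apply: le_trans (hS s Ss); rewrite coshE.
rewrite (integral_expR_shift s m 0%R mZ) -phiE sub0r.
have : 1 <= (expR (- s * (- m)))%:E * phi (- s)%R.
  have := integral_expR_centered_ge1 (- s)%R iZ.
  by rewrite -/m (integral_expR_shift (- s)%R m 0%R mZ) -phiE sub0r.
move=> h.
have expm : (expR (s * - m))%:E <= phi (- s)%R.
  rewrite -[leLHS]mule1; apply: le_trans (lee_wpmul2l _ h) _.
    by rewrite lee_fin expR_ge0.
  rewrite muleA -EFinM -expRD (_ : _ + _ = 0)%R ?expR0 ?mul1e//.
  by ring.
by rewrite muleC; exact: lee_wpmul2l.
Qed.

End exponential_moments.

(** * Functions with bounded differences of independent variables *)

Section tensorization.
Local Open Scope ereal_scope.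
Context {R : realType} {d d1 d2 : measure_display} {Omega : measurableType d}
  {A : measurableType d1} {B : measurableType d2} (P : probability Omega R)
  (U : Omega -> A) (V : Omega -> B) (mU : measurable_fun setT U)
  (mV : measurable_fun setT V) (F : A * B -> R) (mF : measurable_fun setT F)
  (iFV : forall a, P.-integrable setT (fun w => (F (a, V w))%:E)).

Lemma measurable_partial_mean :
  measurable_fun setT (fun a => fine (\int[P]_w (F (a, V w))%:E)).
Proof.
pose V' : {mfun Omega >-> B} := HB.pack V (isMeasurableFun.Build _ _ _ _ _ mV).
have mF' : measurable_fun setT (EFin \o F) by exact/measurable_EFinP.
have E a : \int[P]_w (F (a, V w))%:E = fubini_F (distribution P V') (EFin \o F) a.
  rewrite /fubini_F integral_distribution//; last exact: iFV.
  by apply: measurableT_comp => //; exact: pair1_measurable.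
apply: measurableT_comp => //.
under eq_fun do rewrite E /fubini_F integralE.
apply: emeasurable_funB.
- under eq_fun do under eq_integral do rewrite (funepos_comp (EFin \o F))/=.
  by apply: measurable_fun_fubini_tonelli_F => //; exact: measurable_funepos.
- under eq_fun do under eq_integral do rewrite (funeneg_comp (EFin \o F))/=.
  by apply: measurable_fun_fubini_tonelli_F => //; exact: measurable_funeneg.
Qed.

Hypothesis UV : independent_pair P U V.

(** Write F(U, V) - m = (F(U, V) - H(U)) + (H(U) - m), where H(a) is the mean of
    F(a, V) and m that of H(U).  Integrating over V first bounds the first part
    for each value of U, and then U the second.  The number m is the mean of
    F(U, V) only by Fubini's theorem, whose integrability hypothesis comes from
    the exponential moments at s0 and - s0 just found. *)
Lemma mgf_bounded_tensorization (S : set R) (b1 b2 : R -> R) (s0 : R) :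
  (forall a, mgf_bounded P (fun w => F (a, V w)) S b2) ->
  mgf_bounded P (fun w => fine (\int[P]_w' (F (U w, V w'))%:E)) S b1 ->
  (0 < s0)%R -> S s0 -> S (- s0)%R ->
  mgf_bounded P (fun w => F (U w, V w)) S (fun s => b1 s + b2 s)%R.
Proof.
move=> hF [iH hH] s00 Ss0 SNs0.
pose H a := fine (\int[P]_w (F (a, V w))%:E).
have mH : measurable_fun setT H by exact: measurable_partial_mean.
have mHU : measurable_fun setT (fun w => H (U w)) by exact: measurableT_comp.
have mW : measurable_fun setT (fun w => F (U w, V w)).
  by apply: (measurableT_comp mF); exact/measurable_fun_pair.
set m := fine (\int[P]_w' (H (U w'))%:E) in hH *.
have bound s : S s -> \int[P]_w (expR (s * (F (U w, V w) - m)))%:E <=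
    (expR (b1 s + b2 s))%:E.
  move=> Ss; pose G z := (expR (s * (F z - m)))%:E.
  have mG : measurable_fun setT G by exact: measurable_expR_affine.
  rewrite -[leLHS]/(\int[P]_w G (U w, V w)).
  rewrite (ge0_integral_independent mU mV UV mG); last first.
    by move=> z; rewrite lee_fin expR_ge0.
  apply: (@le_trans _ _ (\int[P]_w
     ((expR (s * (H (U w) - m)))%:E * (expR (b2 s))%:E))).
    apply: ge0_le_integral => //.
    - move=> w _; apply: integral_ge0 => w' _; by rewrite lee_fin expR_ge0.
    - pose V' : {mfun Omega >-> B} := HB.pack V (isMeasurableFun.Build _ _ _ _ _ mV).
      have G0 z : 0 <= G z by rewrite lee_fin expR_ge0.
      have := measurable_fun_fubini_tonelli_F G mG (m2 := distribution P V') G0.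
      move/measurableT_comp => /(_ _ _ _ U mU); apply: eq_measurable_fun => w _ /=.
      rewrite /fubini_F ge0_integral_distribution//.
      by apply: measurableT_comp => //; exact: pair1_measurable.
    - by apply: emeasurable_funM => //; exact: measurable_expR_affine.
    - move=> w _; rewrite /G (integral_expR_shift _ _ _ (H (U w))); last first.
        by apply: (measurableT_comp mF); exact/measurable_fun_pair.
      apply: lee_wpmul2l; first by rewrite lee_fin expR_ge0.
      by have [_] := hF (U w); exact.
  rewrite ge0_integralZr//; last exact: measurable_expR_affine.
  rewrite expRD EFinM; apply: lee_wpmul2r; last exact: hH.
  by rewrite lee_fin expR_ge0.
have iW : P.-integrable setT (EFin \o (fun w => F (U w, V w))).
  apply: (@integrable_expR_moments _ _ _ P _ s0 m) => //.
    by apply: le_lt_trans (bound _ Ss0) _; rewrite ltry.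
  by apply: le_lt_trans (bound _ SNs0) _; rewrite ltry.
have mE : fine (\int[P]_w' (F (U w', V w'))%:E) = m.
  rewrite /m; congr fine.
  have mF' : measurable_fun setT (EFin \o F) by exact/measurable_EFinP.
  have := integral_independent mU mV UV mF' iW iFV => /= ->.
  apply: eq_integral => w _; rewrite fineK//.
  by apply: integrable_fin_num => //; exact: iFV.
split; first exact: iW.
move=> s Ss.
rewrite mE.
exact: (bound s Ss).
Qed.

End tensorization.

Lemma partial_mean_le {R : realType} {d : measure_display}
    {Omega : measurableType d} (P : probability Omega R) (f g : Omega -> R) (c : R) :
  P.-integrable setT (EFin \o f) -> P.-integrable setT (EFin \o g) ->
  (forall w, `|f w - g w| <= c) ->
  `|fine (\int[P]_w (f w)%:E)%E - fine (\int[P]_w (g w)%:E)%E| <= c.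
Proof.
move=> fi gi fg.
rewrite -lee_fin -abse_EFin EFinB !fineK//; last 2 first.
- exact: (integrable_fin_num _ gi).
- exact: (integrable_fin_num _ fi).
rewrite -integralB//.
apply: le_trans (le_abse_integral _ _ _) _ => //.
  by apply: measurable_int; exact: integrableB fi gi.
rewrite -[leRHS](integral_probability_cst P).
apply: ge0_le_integral => //; last by move=> w _; rewrite lee_fin.
by apply: measurableT_comp => //; apply: measurable_int; exact: integrableB fi gi.
Qed.

Lemma measurable_sample {d d' : measure_display} {Omega : measurableType d}
    {U : measurableType d'} (n : nat) (X : 'I_n -> Omega -> U) :
  (forall k, measurable_fun setT (X k)) -> measurable_fun setT (sample X).
Proof.
move=> mX; apply/measurable_fun_tnthP => k.
rewrite [X in measurable_fun _ X](_ : _ = X k)//.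
by apply/funext => w /=; rewrite tnth_mktuple.
Qed.

(** The rectangles are closed under intersection, so that finite measures on
    tuples are determined by their values on them. *)
Lemma tuple_rectangles {d' : measure_display} {U : measurableType d'} (n : nat) :
  (measurable : set (set (n.-tuple U))) =
  <<s [set S | exists2 C : 'I_n -> set U, (forall k, measurable (C k)) &
         S = [set x | forall k, C k (tnth x k)]] >>.
Proof.
apply/seteqP; split.
  apply: smallest_sub; first exact: smallest_sigma_algebra.
  move=> S; rewrite -bigcup_seq => -[/= k _ [B mB <-]].
  apply: sub_sigma_algebra.
  exists (fun j => if j == k then B else setT).
    by move=> j; case: ifP.
  apply/seteqP; split=> x /=; first by move=> [_ Bx] j; case: eqP => // ->.
  by move=> /(_ k); rewrite eqxx.
apply: smallest_sub; first exact: sigma_algebra_measurable.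
move=> _ [C mC ->].
rewrite [X in measurable X](_ : _ = \big[setI/setT]_(k < n) ((@tnth n U ^~ k) @^-1` C k)).
  apply: bigsetI_measurable => k _; rewrite -[X in measurable X]setTI.
  exact: measurable_tnth.
apply/seteqP; split=> x /=.
  by move=> Cx; rewrite -bigcap_seq => k _; exact: Cx.
by rewrite -bigcap_seq => Cx k; apply: Cx; rewrite /= mem_index_enum.
Qed.

(** Mutual independence in the form that passes to subfamilies by choosing some
    C k to be the whole space. *)
Definition rectangle_independent {R : realType} {d d' : measure_display}
    {Omega : measurableType d} {U : measurableType d'} (P : probability Omega R)
    (n : nat) (X : 'I_n -> Omega -> U) :=
  forall C : 'I_n -> set U, (forall k, measurable (C k)) ->
    P [set w | forall k, C k (X k w)] = (\prod_(k < n) P (X k @^-1` C k))%E.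

Section head_tail.
Context {R : realType} {d d' : measure_display} {Omega : measurableType d}
    {U : measurableType d'} (P : probability Omega R)
    (n : nat) (X : 'I_n.+1 -> Omega -> U) (mX : forall k, measurable_fun setT (X k))
    (indX : rectangle_independent P X).

Let tail := fun k : 'I_n => X (lift ord0 k).

Let head_tail (B : set U) (C : 'I_n -> set U) : measurable B ->
  (forall k, measurable (C k)) ->
  P (X ord0 @^-1` B `&` [set w | forall k, C k (tail k w)]) =
  (P (X ord0 @^-1` B) * \prod_(k < n) P (tail k @^-1` C k))%E.
Proof.
move=> mB mC.
pose C' k := if unlift ord0 k is Some j then C j else B.
have mC' k : measurable (C' k) by rewrite /C'; case: unliftP.
have := indX mC'; rewrite big_ord_recl.
rewrite {2}/C' unlift_none; under eq_bigr do rewrite /C' liftK.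
move=> <-; congr (P _); apply/seteqP; split=> w /=.
  by move=> [Bw Cw] k; rewrite /C'; case: unliftP => [j|] -> //; exact: Cw.
move=> C'w; split; first by have := C'w ord0; rewrite /C' unlift_none.
by move=> k; have := C'w (lift ord0 k); rewrite /C' liftK.
Qed.

Lemma rectangle_independent_tail : rectangle_independent P tail.
Proof.
move=> C mC; have := head_tail measurableT mC.
by rewrite preimage_setT setTI probability_setT mul1e.
Qed.

(** For fixed B, both sides of the product rule are finite measures in the event
    of the tail, and they agree on rectangles. *)
Lemma head_tail_independent : independent_pair P (X ord0) (sample tail).
Proof.
have mT : measurable_fun setT (sample tail) by apply: measurable_sample => k; exact: mX.
move=> B S mB mS.
have mXB : measurable (X ord0 @^-1` B) by rewrite -[X in measurable X]setTI; exact: mX.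
have p0 : 0 <= fine (P (X ord0 @^-1` B)) by exact: fine_ge0.
pose m1 : {measure set (n.-tuple U) -> \bar R} :=
  measure_function_pushforward__canonical__measure_function_Measure (mrestr P mXB) mT.
pose m2 : {measure set (n.-tuple U) -> \bar R} :=
  mscale (NngNum p0) (measure_function_pushforward__canonical__measure_function_Measure P mT).
suff : m1 S = m2 S.
  rewrite /m1 /m2 /= /mscale /= /pushforward /mrestr /= fineK ?fin_num_measure//.
  by rewrite setIC.
move: S mS; apply: (measure_unique _ (fun=> setT) (@tuple_rectangles _ U n)).
- move=> _ _ [C1 m1C ->] [C2 m2C ->]; exists (fun k => C1 k `&` C2 k).
    by move=> k; exact: measurableI.
  apply/seteqP; split=> x /=; first by move=> [x1 x2] k; split.
  by move=> h; split=> k; have [] := h k.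
- by move=> _; exists (fun=> setT) => //; apply/seteqP; split.
- by rewrite bigcup_const.
- move=> _ [C mC ->].
  rewrite /m1 /m2 /= /mscale /= /pushforward /mrestr /= fineK ?fin_num_measure//.
  have E : sample tail @^-1` [set x | forall k, C k (tnth x k)] =
      [set w | forall k, C k (tail k w)].
    by apply/seteqP; split=> w /= h k; have := h k; rewrite tnth_mktuple.
  rewrite E setIC head_tail//; congr (_ * _)%E.
  by rewrite rectangle_independent_tail.
- move=> _; rewrite /m1 /= /pushforward /mrestr.
  rewrite preimage_setT setTI.
  exact: le_lt_trans (probability_le1 P mXB) (ltry 1).
Qed.

End head_tail.

Lemma mutually_independent_rectangle {R : realType} {d d' : measure_display}
    {Omega : measurableType d} {U : measurableType d'} (P : probability Omega R)
    (n : nat) (X : 'I_n -> Omega -> U) :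
  mutually_independent P X -> rectangle_independent P X.
Proof.
move=> indX C mC; have := indX (finset.setTfor 'I_n) C mC.
under [in X in _ = X -> _]eq_bigl do rewrite finset.in_setT.
move=> <-; congr (P _); apply/seteqP; split=> w /= h k; first by move=> _; exact: h.
by apply: h; rewrite /= finset.in_setT.
Qed.

(** McDiarmid's argument with D in place of constants.  D need not be measurable:
    it enters only through the class of functions g of one coordinate for which
    a bound is assumed.  That class contains the mean of h over all coordinates
    but the first, as a function of the first. *)
Lemma bounded_differences_mgf_bounded {R : realType} {d d' : measure_display}
    {Omega : measurableType d} {U : measurableType d'} (P : probability Omega R)
    (D : U -> U -> R) (S : set R) (s0 : R) (n : nat) (X : 'I_n -> Omega -> U)
    (b : 'I_n -> R -> R) (h : n.-tuple U -> R) :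
  0 < s0 -> S s0 -> S (- s0) ->
  (forall k, measurable_fun setT (X k)) -> rectangle_independent P X ->
  (forall k (g : U -> R), measurable_fun setT g ->
     (forall x y, `|g x - g y| <= D x y) ->
     mgf_bounded P (fun w => g (X k w)) S (b k)) ->
  measurable_fun setT h ->
  (forall (x y : n.-tuple U) k, (forall j, j != k -> tnth x j = tnth y j) ->
     `|h x - h y| <= D (tnth x k) (tnth y k)) ->
  mgf_bounded P (fun w => h (sample X w)) S (fun s => \sum_(k < n) b k s).
Proof.
move=> s00 Ss0 SNs0.
elim: n => [|n IH] in X b h *; move=> mX indX hX mh hD.
  have hE w : h (sample X w) = h [tuple] by congr h; exact: tuple0.
  split.
    rewrite (_ : _ \o _ = EFin \o cst (h [tuple])).
      exact: finite_measure_integrable_cst.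
    by apply/funext => w /=; rewrite hE.
  move=> s _; rewrite big_ord0 expR0.
  under eq_integral do rewrite hE.
  under [X in fine X]eq_integral do rewrite hE.
  by rewrite !integral_probability_cst/= subrr mulr0 expR0.
pose tail := fun k : 'I_n => X (lift ord0 k).
pose F (z : U * n.-tuple U) := h [tuple of z.1 :: z.2].
have mF : measurable_fun setT F.
  apply: measurableT_comp => //.
  exact: (measurable_cons measurable_fst measurable_snd).
have mtail k : measurable_fun setT (tail k) by exact: mX.
have mV : measurable_fun setT (sample tail) by exact: measurable_sample.
have sampleE w : sample X w = [tuple of X ord0 w :: sample tail w].
  apply: eq_from_tnth => k; rewrite tnth_mktuple.
  case: (unliftP ord0 k) => [j|] ->; last by rewrite tnth0.
  by rewrite tnthS tnth_mktuple.
have hF a : mgf_bounded P (fun w => F (a, sample tail w)) S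
    (fun s => \sum_(k < n) b (lift ord0 k) s).
  apply: (IH tail (fun k => b (lift ord0 k)) (fun t => F (a, t))) => //.
  - exact: rectangle_independent_tail.
  - by move=> k; exact: hX.
  - by apply: measurableT_comp => //; exact: pair1_measurable.
  - move=> x y k xy; rewrite /F/=.
    have := hD [tuple of a :: x] [tuple of a :: y] (lift ord0 k).
    rewrite !tnthS; apply => j; case: (unliftP ord0 j) => [i|] ->; last by rewrite !tnth0.
    rewrite !tnthS => ik; apply: xy; apply: contra_neq ik => ->.
    by [].
have iFV a : P.-integrable setT (fun w => (F (a, sample tail w))%:E) by have [] := hF a.
under eq_fun do rewrite sampleE.
under [X in mgf_bounded _ _ _ X]eq_fun do rewrite big_ord_recl.
apply: (mgf_bounded_tensorization (F := F) _ _ _ _ _ hF _ s00) => //.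
- exact: head_tail_independent.
- apply: (hX ord0 (fun a => fine (\int[P]_w (F (a, sample tail w))%:E)%E)).
    exact: measurable_partial_mean.
  move=> x y; apply: partial_mean_le; [exact: iFV|exact: iFV|] => w.
  have := hD [tuple of x :: sample tail w] [tuple of y :: sample tail w] ord0.
  rewrite !tnth0; apply => j; case: (unliftP ord0 j) => [i|] ->; last by rewrite eqxx.
  by rewrite !tnthS.
Qed.

(** * Hyperbolic cosine moments from the theta norms *)

Section cosh_series.
Context {R : realType}.

Lemma cvg_double : (m.*2 @[m --> \oo] --> \oo)%N.
Proof.
move=> B [N _ NB]; exists N => // m /= Nm; apply: NB => /=.
by rewrite (leq_trans Nm)// -addnn leq_addr.
Qed.

Lemma cosh_even_series (x : R) (m : nat) :
  \sum_(0 <= p < m) x ^+ p.*2 / (p.*2)`!%:R =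
  (series (exp_coeff x) m.*2 + series (exp_coeff (- x)) m.*2) / 2.
Proof.
elim: m => [|m IH]; first by rewrite /series/= !big_geq// addr0 mul0r.
rewrite big_nat_recr//= IH doubleS /series/= !big_nat_recr//= /exp_coeff/=.
rewrite !exprS exprNn -signr_odd odd_double expr0 mul1r.
by set y := _ / (m.*2)`!%:R; set z := (m.*2).+1`!%:R; field.
Qed.

Lemma cvg_cosh_series (x : R) :
  series (fun p => x ^+ p.*2 / (p.*2)`!%:R) @ \oo --> cosh x.
Proof.
have E y : series (exp_coeff y) m.*2 @[m --> \oo] --> expR y.
  apply: (cvg_comp _ _ cvg_double); exact: is_cvg_series_exp_coeff.
rewrite (_ : series _ =
  fun m => (series (exp_coeff x) m.*2 + series (exp_coeff (- x)) m.*2) / 2); last first.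
  by apply/funext => m; rewrite -cosh_even_series.
by apply: cvgMl; apply: cvgD; exact: E.
Qed.

Lemma nneseries_EFin (a : nat -> R) (l : R) :
  series a @ \oo --> l -> (\sum_(p <oo) (a p)%:E = l%:E)%E.
Proof.
move=> al; apply/cvg_lim => //.
rewrite (_ : (fun n => _) = EFin \o series a).
  by apply: cvg_EFin => //; exact: nearW.
by apply/funext => m; rewrite /= sumEFin.
Qed.

Lemma even_power_ge0 (x : R) p : 0 <= x ^+ p.*2.
Proof. by rewrite -mul2n exprM exprn_ge0// sqr_ge0. Qed.

(** Termwise integration of the Taylor series of cosh, which involves even
    moments only. *)
Lemma integral_cosh_le {d : measure_display} {Omega : measurableType d}
    (P : probability Omega R) (W : Omega -> R) (u : R) (a : nat -> R) (l : R) :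
  measurable_fun setT W ->
  (forall p, ((u ^+ p.*2 / (p.*2)`!%:R)%:E * \int[P]_w (W w ^+ p.*2)%:E
                <= (a p)%:E)%E) ->
  series a @ \oo --> l ->
  (\int[P]_w (cosh (u * W w))%:E <= l%:E)%E.
Proof.
move=> mW ha al.
have mWp p : measurable_fun setT (fun w => W w ^+ p) by exact: measurable_funX.
have c0 p : 0 <= u ^+ p.*2 / (p.*2)`!%:R by rewrite divr_ge0 ?even_power_ge0.
rewrite -(nneseries_EFin al).
have coshE (y : R) : (cosh y)%:E = (\sum_(p <oo) (y ^+ p.*2 / (p.*2)`!%:R)%:E)%E.
  by apply/esym; apply: nneseries_EFin; exact: cvg_cosh_series.
under eq_integral do rewrite coshE.
rewrite integral_nneseries//; last 2 first.
- move=> p; apply/measurable_EFinP.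
  under eq_fun do rewrite exprMn mulrAC.
  by apply: measurable_funM => //; exact: mWp.
- by move=> p w _; rewrite lee_fin divr_ge0 ?even_power_ge0.
apply: lee_nneseries => [p _ _|p _].
  by apply: integral_ge0 => w _; rewrite lee_fin divr_ge0 ?even_power_ge0.
apply: le_trans (ha p).
under eq_integral do rewrite exprMn mulrAC EFinM.
rewrite ge0_integralZl//.
- exact/measurable_EFinP.
- by move=> w _; rewrite lee_fin even_power_ge0.
- by rewrite lee_fin.
Qed.

End cosh_series.

Section theta_norms.
Context {R : realType} {d : measure_display} {Omega : measurableType d}
  (P : probability Omega R).

Lemma moment_le_of_root (E : \bar R) (c N : R) (q : nat) :
  (0 <= E)%E -> 0 < c -> 0 <= N -> (0 < q)%N ->
  ((E / c%:E) `^ q%:R^-1 <= N%:E)%E -> (E <= (c * N ^+ q)%:E)%E.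
Proof.
move=> E0 c0 N0 q0 h.
have Ec0 : (0 <= E / c%:E)%E by rewrite mule_ge0// inve_ge0 lee_fin ltW.
have : (E / c%:E <= (N ^+ q)%:E)%E.
  rewrite -[leLHS]poweRe1// -(@mulVf _ q%:R) ?pnatr_eq0 -?lt0n// poweRrM.
  rewrite -powR_mulrn// -poweR_EFin.
  by apply: gt0_ler_poweR => //; rewrite ?in_itv/= ?leey ?poweR_ge0 ?lee_fin ?N0.
by rewrite inver gt_eqF// lee_pdivrMr// -EFinM mulrC.
Qed.

Lemma sup_term_le_fine (S : set (\bar R)) x : S x -> (0 <= x)%E ->
  (ereal_sup S < +oo)%E -> (x <= (fine (ereal_sup S))%:E)%E.
Proof.
move=> Sx x0 Soo; have xS := ereal_sup_ubound Sx.
by rewrite fineK// ge0_fin_numE// (le_trans x0).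
Qed.

Lemma norm_theta1_ge0 (W : Omega -> R) : 0 <= fine (norm_theta1 P W).
Proof.
apply: fine_ge0; apply: le_trans (ereal_sup_ubound _); last by exists 1%N.
exact: poweR_ge0.
Qed.

Lemma norm_theta2_ge0 (W : Omega -> R) : 0 <= fine (norm_theta2 P W).
Proof.
apply: fine_ge0; apply: le_trans (ereal_sup_ubound _); last by exists 1%N.
exact: poweR_ge0.
Qed.

Lemma moment_le_norm_theta1 (W : Omega -> R) (p : nat) :
  (0 < p)%N -> (norm_theta1 P W < +oo)%E ->
  (\int[P]_w (`|W w| ^+ p)%:E <= (p`!%:R * fine (norm_theta1 P W) ^+ p)%:E)%E.
Proof.
move=> p0 Woo; apply: moment_le_of_root.
- by apply: integral_ge0 => w _; rewrite lee_fin exprn_ge0.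
- by rewrite ltr0n fact_gt0.
- exact: norm_theta1_ge0.
- by [].
- apply: sup_term_le_fine => //; last exact: poweR_ge0.
  by exists p => //; rewrite unlock.
Qed.

Lemma odd_dfact_gt0 p : (0 < odd_dfact p)%N.
Proof. by rewrite prodn_gt0. Qed.

Lemma moment_le_norm_theta2 (W : Omega -> R) (p : nat) :
  (0 < p)%N -> (norm_theta2 P W < +oo)%E ->
  (\int[P]_w (W w ^+ p.*2)%:E
    <= ((odd_dfact p)%:R * fine (norm_theta2 P W) ^+ p.*2)%:E)%E.
Proof.
move=> p0 Woo; apply: moment_le_of_root.
- by apply: integral_ge0 => w _; rewrite lee_fin even_power_ge0.
- by rewrite ltr0n odd_dfact_gt0.
- exact: norm_theta2_ge0.
- by rewrite double_gt0.
- apply: sup_term_le_fine => //; last exact: poweR_ge0.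
  by exists p => //; rewrite unlock.
Qed.

Lemma fact_double p : ((p.*2)`! = odd_dfact p * (2 ^ p * p`!))%N.
Proof.
rewrite /odd_dfact; elim: p => [|p IH]; first by rewrite big_ord0.
rewrite doubleS !factS IH big_ord_recr/= expnS -doubleS -!mul2n; ring.
Qed.

(** The double factorial in the theta_2 norm cancels against (2p)!, leaving the
    exponential series of u^2 N^2 / 2. *)
Lemma integral_cosh_le_theta2 (W : Omega -> R) (u : R) :
  measurable_fun setT W -> (norm_theta2 P W < +oo)%E ->
  (\int[P]_w (cosh (u * W w))%:E
     <= (expR (u ^+ 2 * fine (norm_theta2 P W) ^+ 2 / 2))%:E)%E.
Proof.
move=> mW Woo; set N := fine _.
apply: (@integral_cosh_le _ _ _ _ _ _ (exp_coeff (u ^+ 2 * N ^+ 2 / 2))) => //.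
  (* The norms bound moments of positive order; the term p = 0 is 1. *)
  move=> [|p].
    rewrite /exp_coeff /= !expr0 double0 fact0 divr1 mul1e.
    by under eq_integral do rewrite expr0; rewrite integral_probability_cst.
  apply: le_trans (lee_wpmul2l _ (moment_le_norm_theta2 (ltn0Sn p) Woo)) _.
    by rewrite lee_fin divr_ge0 ?even_power_ge0.
  rewrite -EFinM lee_fin -/N le_eqVlt; apply/orP; left; apply/eqP.
  move: p.+1 => q; rewrite /exp_coeff /= fact_double !natrM natrX -mul2n !exprM !exprMn exprVn.
  by field; rewrite !pnatr_eq0 -!lt0n fact_gt0 odd_dfact_gt0 expf_neq0 ?pnatr_eq0.
exact: is_cvg_series_exp_coeff.
Qed.

(** The factorials cancel and leave the geometric series of z = u^2 N^2, with sum
    1 + z / (1 - z) <= exp (z / (1 - z)); moreover z <= |u| N <= M.  One M may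
    serve several W with different norms. *)
Lemma integral_cosh_le_theta1 (W : Omega -> R) (u M : R) :
  measurable_fun setT W -> (norm_theta1 P W < +oo)%E ->
  `|u| * fine (norm_theta1 P W) <= M -> M < 1 ->
  (\int[P]_w (cosh (u * W w))%:E
     <= (expR (u ^+ 2 * fine (norm_theta1 P W) ^+ 2 / (1 - M)))%:E)%E.
Proof.
move=> mW Woo; set N := fine _ => uN M1.
have N0 : 0 <= N by exact: norm_theta1_ge0.
have uN0 : 0 <= `|u| * N by rewrite mulr_ge0.
pose z := u ^+ 2 * N ^+ 2.
have zE : z = (`|u| * N) ^+ 2 by rewrite exprMn real_normK// num_real.
have z0 : 0 <= z by rewrite zE sqr_ge0.
have zM : z <= M by rewrite zE; nra.
apply: (@le_trans _ _ (1 / (1 - z))%:E); last first.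
  rewrite lee_fin; apply: (@le_trans _ _ (1 + z / (1 - z))).
    have z1 : 1 - z != 0 by rewrite subr_eq0 gt_eqF//; lra.
    by rewrite le_eqVlt; apply/orP; left; apply/eqP; field.
  apply: le_trans (expR_ge1Dx _) _; rewrite ler_expR.
  by rewrite ler_wpM2l// lef_pV2 ?posrE; lra.
apply: (@integral_cosh_le _ _ _ _ _ _ (geometric 1 z)) => //.
  move=> [|p].
    rewrite /= !expr0 double0 fact0 divr1 mul1e mulr1.
    by under eq_integral do rewrite expr0; rewrite integral_probability_cst.
  under eq_integral do rewrite -[W _ ^+ _]ger0_norm ?even_power_ge0// normrX.
  apply: le_trans (lee_wpmul2l _ (@moment_le_norm_theta1 _ _ _ Woo)) _ => //.
    by rewrite lee_fin divr_ge0 ?even_power_ge0.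
  rewrite -EFinM lee_fin -/N le_eqVlt; apply/orP; left; apply/eqP.
  rewrite /geometric [RHS]mul1r /z; move: p.+1 => q.
  rewrite -mul2n exprMn -!exprM.
  by field; rewrite pnatr_eq0 -lt0n fact_gt0.
rewrite -[X in _ --> X]/(1 * _); apply: cvg_geometric_series.
by rewrite ger0_norm//; lra.
Qed.

End theta_norms.

(** * Tail bounds *)

Section bernstein.
Context {R : realType} {d : measure_display} {Omega : measurableType d}
  (P : probability Omega R).

Lemma measurable_norm_gt (W : Omega -> R) (t : R) :
  measurable_fun setT W -> measurable [set w | t < `|W w|]%R.
Proof.
move=> mW; rewrite (_ : mkset _ = (@Num.norm R R \o W) @^-1` `]t, +oo[).
  rewrite -[X in measurable X]setTI.
  have mn : measurable_fun setT (@Num.norm R R \o W) by exact: measurableT_comp.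
  by apply: mn => //; exact: measurable_itv.
by apply/seteqP; split => w /=; rewrite in_itv/= andbT.
Qed.

Lemma two_sided_chernoff (W : Omega -> R) (s t c : R) :
  measurable_fun setT W -> 0 < s ->
  ('M_P W s <= (expR c)%:E)%E -> ('M_P W (- s) <= (expR c)%:E)%E ->
  (P [set w | t < `|W w|]%R <= (2 * expR (c - s * t))%:E)%E.
Proof.
move=> mW s0 h1 h2.
have mNW : measurable_fun setT (\- W) by exact: measurableT_comp.
pose W1 : {mfun Omega >-> R} := HB.pack W (isMeasurableFun.Build _ _ _ _ _ mW).
pose W2 : {mfun Omega >-> R} := HB.pack (\- W) (isMeasurableFun.Build _ _ _ _ _ mNW).
have half (X : {mfun Omega >-> R}) : ('M_P X s <= (expR c)%:E)%E ->
    (P [set w | X w >= t]%R <= (expR (c - s * t))%:E)%E.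
  move=> hX; apply: le_trans (chernoff (P := P) X t s0) _.
  by rewrite expRD EFinM lee_wpmul2r// lee_fin expR_ge0.
have mset (X : {mfun Omega >-> R}) : measurable [set w | X w >= t]%R.
  rewrite (_ : mkset _ = X @^-1` `[t, +oo[).
    by apply: measurable_funPTI => //; exact: measurable_itv.
  by apply/seteqP; split => w /=; rewrite in_itv/= andbT.
apply: (@le_trans _ _ (P ([set w | W1 w >= t]%R `|` [set w | W2 w >= t]%R))).
  apply: le_measure; rewrite ?inE; [exact: measurable_norm_gt|exact: measurableU|].
  move=> w /=; rewrite ltr_normr => /orP[] h; [left|right]; exact: ltW.
apply: le_trans (measureU2 P (mset W1) (mset W2)) _.
rewrite (_ : 2 * _ = expR (c - s * t) + expR (c - s * t)); last by ring.
rewrite EFinD; apply: leeD; apply: half => //.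
rewrite (_ : 'M_P W2 s = 'M_P W (- s))//.
by rewrite /mmt_gen_fun; congr expectation; apply/funext => w /=; rewrite mulrN mulNr.
Qed.

(** Chernoff's bound at s = t / (eta + M t): there 1 - M s = eta / (eta + M t) and
    the exponent is - t^2 / (2 (eta + M t)).  If eta = 0 < M this s is
    inadmissible, and s = 1 / (2 M) gives the same tail; if eta = M = 0, every s
    is admissible and the tail at t > 0 vanishes. *)
Lemma bernstein_tail (W : Omega -> R) (eta M : R) :
  measurable_fun setT W -> 0 <= eta -> 0 <= M ->
  (forall s, M * `|s| < 1 ->
     ('M_P W s <= (expR (eta * s ^+ 2 / (2 * (1 - M * `|s|))))%:E)%E) ->
  forall t : R, 0 <= t ->
    (P [set w | t < `|W w|]%R <=
       2%:E * expeR (- (t ^+ 2)%:E / (2 * eta + 2 * M * t)%:E))%E.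
Proof.
move=> mW eta0 M0 hW t t0.
have tail s : 0 < s -> M * s < 1 ->
    (P [set w | t < `|W w|]%R
      <= (2 * expR (eta * s ^+ 2 / (2 * (1 - M * s)) - s * t))%:E)%E.
  move=> s0 Ms; have ns : `|s| = s by rewrite gtr0_norm.
  apply: two_sided_chernoff => //.
    by have := hW s; rewrite ns; exact.
  by have := hW (- s); rewrite normrN ns sqrrN; exact.
move: t0; rewrite le_eqVlt => /predU1P[<-|t0].
  rewrite expr0n/= oppr0 mul0e expeR0 mule1.
  apply: le_trans (probability_le1 P (measurable_norm_gt _ mW)) _.
  by rewrite lee_fin ler1n.
have [v0|v0] := eqVneq (2 * eta + 2 * M * t) 0.
  have eta00 : eta = 0 by nra.
  have M00 : M = 0 by nra.
  rewrite v0 inve0 -EFinN lt0_muley/= ?lte_fin ?oppr_lt0 ?exprn_gt0// mule0.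
  (* 2 e^(- s t) <= e for this s, by 1 + x <= e^x at x = 2 / e. *)
  apply/lee_addgt0Pr => e e0; rewrite add0e.
  have s0 : 0 < 2 / (e * t) by rewrite divr_gt0// mulr_gt0.
  apply: le_trans (tail _ s0 _) _; first by rewrite M00 mul0r.
  rewrite eta00 !mul0r sub0r lee_fin.
  rewrite (_ : _ * t = 2 / e); last by field; rewrite !gt_eqF.
  rewrite expRN ler_pdivrMr ?expR_gt0// -ler_pdivrMl//.
  by apply: le_trans (expR_ge1Dx _); rewrite mulrC lerDr.
have v1 : 0 < eta + M * t.
  have v2 : 0 <= eta + M * t by rewrite addr_ge0// mulr_ge0// ltW.
  rewrite lt_neqAle v2 andbT eq_sym; apply: contra_neq v0 => v0.
  by rewrite -mulrA -mulrDr v0 mulr0.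
have [M00|M00] := eqVneq eta 0.
  have M1 : 0 < M by move: v1; rewrite M00 add0r pmulr_lgt0.
  have s0 : 0 < (2 * M)^-1 by rewrite invr_gt0 mulr_gt0.
  apply: le_trans (tail _ s0 _) _.
    by rewrite invfM mulrCA divff ?gt_eqF// mulr1 invf_lt1// ltr1n.
  rewrite inver (negbTE v0) -EFinN -EFinM /= lee_fin ler_pM2l// ler_expR M00.
  rewrite le_eqVlt; apply/orP; left; apply/eqP; field.
  by rewrite !gt_eqF.
have eta1 : 0 < eta by rewrite lt_neqAle eq_sym M00.
have s0 : 0 < t / (eta + M * t) by rewrite divr_gt0.
apply: le_trans (tail _ s0 _) _.
  by rewrite mulrA ltr_pdivrMr// mul1r ltrDr.
rewrite inver (negbTE v0) -EFinN -EFinM /= lee_fin ler_pM2l// ler_expR.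
rewrite le_eqVlt; apply/orP; left; apply/eqP; field.
by rewrite v0 gt_eqF//= addrK.
Qed.

End bernstein.

(** * Concentration of the maximum likelihood estimator *)

Theorem theorem1 (R : realType)
  (d : measure_display) (Omega : measurableType d) (P : probability Omega R)
  (T : pmetricType R) (n : nat) (n_gt0 : (0 < n)%N)
  (X Y : 'I_n -> {RV P >-> borel T})
  (X_iid : iid P X)
  (XY_copy : independent_copy P X Y)
  (mdistXY : forall k,
     measurable_fun setT (fun w => mdist (X k w : T) (Y k w : T)))
  (Theta : set R) (Theta_itv : is_interval Theta)
  (nu : {measure set (borel T) -> \bar R}) (p : T -> R -> R)
  (p_density : forall theta, Theta theta ->
     positive_density nu (p ^~ theta : borel T -> R))
  (l_C3 : forall x, continuously_derivable_on Theta 3 (neg_log p x))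
  (f : {mfun n.-tuple (borel T) >-> R})
  (f_mle : forall x : n.-tuple T,
     is_argmin Theta
       (fun theta => n%:R^-1 * \sum_(k < n) neg_log p (tnth x k) theta) (f x))
  (cH cl : R) (cH_gt0 : 0 < cH) (cl_gt0 : 0 < cl)
  (l_convex : forall x,
     (cH%:E <=
      ereal_inf [set (deriven_on Theta 2 (neg_log p x) theta)%:E
                | theta in Theta])%E)
  (l_lipschitz : forall theta, Theta theta -> forall x y : T,
     `|derive_on Theta (neg_log p x) theta - derive_on Theta (neg_log p y) theta|
       <= cl * mdist x y) :
  let hat_theta : Omega -> R := fun w => f (sample X w) in
  let W : Omega -> R := fun w => hat_theta w - fine ('E_P[hat_theta])%E in
  let dXY k : Omega -> R := fun w => mdist (X k w : T) (Y k w : T) in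
  ((forall k, (norm_theta2 P (dXY k) < +oo)%E) ->
     let V := \sum_(k < n) fine (norm_theta2 P (dXY k)) ^+ 2 in
     let v := 16 * cl ^+ 2 / (cH ^+ 2 * n%:R ^+ 2) * V in
     subG P W v /\
     (* extended division: the bound is 0 when v = 0 < t *)
     forall t : R, 0 <= t ->
       (P [set w | t < `|W w|]%R <= 2%:E * expeR (- (t ^+ 2)%:E / v%:E))%E)
  /\
  ((forall k, (norm_theta1 P (dXY k) < +oo)%E) ->
     let V := \sum_(k < n) fine (norm_theta1 P (dXY k)) ^+ 2 in
     let m := \big[Num.max/0]_(k < n) fine (norm_theta1 P (dXY k)) in
     subGamma P W (2 * cl ^+ 2 / (cH ^+ 2 * n%:R ^+ 2) * V)
                  (cl / (cH * n%:R) * m) /\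
     forall t : R, 0 <= t ->
       (P [set w | t < `|W w|]%R <=
        2%:E * expeR (- (t ^+ 2)%:E /
          (4 * cl ^+ 2 / (cH ^+ 2 * n%:R ^+ 2) * V
           + 2 * cl / (cH * n%:R) * m * t)%:E))%E).
Proof.
move=> hat_theta W dXY.
have n0 : 0 < n%:R :> R by rewrite ltr0n.
pose c := cl / (cH * n%:R).
have c0 : 0 < c by rewrite divr_gt0// mulr_gt0.
have f_lip (x y : n.-tuple T) k : (forall j, j != k -> tnth x j = tnth y j) ->
    `|f x - f y| <= c * mdist (tnth x k) (tnth y k).
  exact: (mle_bounded_differences n_gt0 Theta_itv l_C3 f_mle).
have mX k : measurable_fun setT (X k : Omega -> borel T) by exact: measurable_funP.
have mY k : measurable_fun setT (Y k : Omega -> borel T) by exact: measurable_funP.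
have msX : measurable_fun setT (sample X : Omega -> n.-tuple (borel T)).
  exact: measurable_sample.
have mhat : measurable_fun setT hat_theta.
  by apply: (measurableT_comp _ msX); exact: measurable_funP.
have mW : measurable_fun setT W by exact: measurable_funB.
(* Both parts: a bound on the cosh moments of the scaled distances for M |s| < 1 bounds
   the moment generating function of W there. Part (a) takes M = 0. *)
have concentration (M : R) (b : 'I_n -> R -> R) : 0 <= M ->
    (forall k s, M * `|s| < 1 ->
       (\int[P]_w (cosh (s * c * dXY k w))%:E <= (expR (b k s))%:E)%E) ->
    centered P W /\
    forall s, M * `|s| < 1 -> ('M_P W s <= (expR (\sum_(k < n) b k s))%:E)%E.
  move=> M0 hb.
  have [ihat hhat] : mgf_bounded P hat_theta [set s | M * `|s| < 1]
      (fun s => \sum_(k < n) b k s).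
    pose s0 := (M + 1)^-1.
    have s00 : 0 < s0 by rewrite invr_gt0 ltr_wpDl.
    have Ms0 : M * `|s0| < 1.
      by rewrite gtr0_norm// ltr_pdivrMr ?mul1r ?ltrDl// ltr_wpDl.
    apply: (@bounded_differences_mgf_bounded _ _ _ _ _ P
      (fun x y : borel T => c * mdist (x : T) (y : T)) _ s0) => //.
    - by rewrite /= normrN.
    - by apply: mutually_independent_rectangle; case: X_iid.
    - move=> k g mg g_lip.
      have mgX : measurable_fun setT (g \o X k) by exact: measurableT_comp.
      have mgY : measurable_fun setT (g \o Y k) by exact: measurableT_comp.
      (* The independent copy is one of the whole sample; pull events of the k-th
         coordinate back to events of the sample. *)
      have mgk S : measurable S ->
          measurable ((fun x : n.-tuple (borel T) => g (tnth x k)) @^-1` S).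
        move=> mS; rewrite -[X in measurable X]setTI.
        exact: (measurableT_comp mg (measurable_tnth k)).
      have preimX (Z : 'I_n -> Omega -> borel T) S :
          sample Z @^-1` ((fun x => g (tnth x k)) @^-1` S) = (g \o Z k) @^-1` S.
        by apply/seteqP; split=> w /=; rewrite tnth_mktuple.
      apply: (@mgf_bounded_symmetrization _ _ _ P _ (g \o Y k) _ _ s0) => //.
      + move=> S1 S2 mS1 mS2.
        by have := XY_copy.2 _ _ (mgk _ mS1) (mgk _ mS2); rewrite !preimX.
      + by move=> S mS; have := XY_copy.1 _ (mgk _ mS); rewrite !preimX.
      + move=> s Ss; apply: le_trans (hb k s Ss).
        apply: ge0_le_integral => //.
        * by move=> w _; rewrite lee_fin cosh_ge0.
        * apply/measurable_EFinP; apply: measurableT_comp measurable_cosh _.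
          by apply: measurable_funM => //; exact: measurable_funB.
        * apply/measurable_EFinP; apply: measurableT_comp measurable_cosh _.
          by apply: measurable_funM => //; exact: mdistXY.
        * move=> w _; rewrite lee_fin; apply: cosh_le.
          rewrite -mulrA [leLHS]normrM [leRHS]normrM ler_wpM2l//.
          exact: le_trans (g_lip _ _) (ler_norm _).
  have WE : W = fun w => hat_theta w - fine (\int[P]_w' (hat_theta w')%:E)%E.
    by rewrite /W unlock.
  split.
    split.
      have -> : EFin \o W = ((EFin \o hat_theta)
          \- (EFin \o cst (fine (\int[P]_w' (hat_theta w')%:E)%E)))%E.
        by rewrite WE; apply/funext.
      by apply: integrableB => //; exact: finite_measure_integrable_cst.
    by rewrite unlock WE; exact: integral_centered.
  move=> s Ss; apply: le_trans (hhat s Ss).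
  rewrite /mmt_gen_fun unlock WE le_eqVlt; apply/orP; left; apply/eqP.
  by apply: eq_integral => w _; rewrite /= mulrC.
split=> norm_fin V.
- move=> v.
  have V0 : 0 <= V by apply: sumr_ge0 => k _; rewrite sqr_ge0.
  have vE : v = 16 * (c ^+ 2 * V).
    by rewrite /v /c; field; rewrite (gt_eqF n0) (gt_eqF cH_gt0).
  have [] := concentration 0 (fun k s => (s * c) ^+ 2 * fine (norm_theta2 P (dXY k)) ^+ 2 / 2).
  + by [].
  + move=> k s _; apply: integral_cosh_le_theta2; first exact: mdistXY.
    exact: norm_fin.
  move=> cW mgfW.
  have {}mgfW s : ('M_P W s <= (expR (s ^+ 2 * (c ^+ 2 * V) / 2))%:E)%E.
    rewrite (_ : s ^+ 2 * (c ^+ 2 * V) / 2 =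
      \sum_(k < n) (s * c) ^+ 2 * fine (norm_theta2 P (dXY k)) ^+ 2 / 2).
      by apply: mgfW; rewrite mul0r ltr01.
    by rewrite -mulr_suml -mulr_sumr -/V; ring.
  have cV : 0 <= c ^+ 2 * V by rewrite mulr_ge0// sqr_ge0.
  split.
    split => // s; apply: le_trans (mgfW s) _.
    by rewrite lee_fin ler_expR vE; have := sqr_ge0 s; nra.
  move=> t t0.
  (* The Bernstein tail with eta = v / 2 and M = 0. *)
  rewrite [v](_ : _ = 2 * (v / 2) + 2 * 0 * t); last by field.
  apply: bernstein_tail => //; first by rewrite vE; nra.
  move=> s _; apply: le_trans (mgfW s) _.
  by rewrite lee_fin ler_expR mul0r subr0 vE; have := sqr_ge0 s; nra.
- move=> m.
  have V0 : 0 <= V by apply: sumr_ge0 => k _; rewrite sqr_ge0.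
  have m0 : 0 <= m by apply: bigmax_ge_id.
  pose eta := 2 * cl ^+ 2 / (cH ^+ 2 * n%:R ^+ 2) * V.
  have etaE : eta = 2 * (c ^+ 2 * V).
    by rewrite /eta /c; field; rewrite (gt_eqF n0) (gt_eqF cH_gt0).
  have M0 : 0 <= c * m by rewrite mulr_ge0// ltW.
  have eta0 : 0 <= eta by rewrite etaE mulr_ge0// mulr_ge0// sqr_ge0.
  have [] := concentration (c * m) (fun k s =>
    (s * c) ^+ 2 * fine (norm_theta1 P (dXY k)) ^+ 2 / (1 - c * m * `|s|)).
  + by [].
  + move=> k s Ss; apply: integral_cosh_le_theta1 => //; first exact: mdistXY.
    rewrite (_ : `|s * c| * _ = c * fine (norm_theta1 P (dXY k)) * `|s|).
      apply: ler_wpM2r => //.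
      by apply: ler_wpM2l; [exact: ltW|exact: le_bigmax].
    by rewrite normrM (gtr0_norm c0); ring.
  move=> cW mgfW.
  have {}mgfW s : c * m * `|s| < 1 ->
      ('M_P W s <= (expR (eta * s ^+ 2 / (2 * (1 - c * m * `|s|))))%:E)%E.
    move=> Ss; rewrite (_ : eta * s ^+ 2 / (2 * (1 - c * m * `|s|)) =
      \sum_(k < n) (s * c) ^+ 2 * fine (norm_theta1 P (dXY k)) ^+ 2
                      / (1 - c * m * `|s|)); first exact: mgfW.
    rewrite -mulr_suml -mulr_sumr -/V etaE; field.
    by rewrite subr_eq0 gt_eqF.
  rewrite -/eta -/c; split.
    split => // s s0 sM.
    have Ss : c * m * `|s| < 1.
      move: sM; have [->|cm0] := eqVneq (c * m) 0; first by rewrite mul0r ltr01.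
      rewrite inver (negbTE cm0) lte_fin => sM.
      have cm_gt0 : 0 < c * m by rewrite lt_neqAle eq_sym cm0.
      by rewrite mulrC -ltr_pdivlMr// div1r.
    rewrite -[leRHS]expeRK lee_lne ?in_itv/= ?leey ?andbT.
    - exact: mgfW.
    - by apply: expectation_ge0 => w; exact: expR_ge0.
    - by rewrite lee_fin expR_ge0.
  move=> t t0.
  rewrite (_ : 4 * cl ^+ 2 / (cH ^+ 2 * n%:R ^+ 2) * V + 2 * cl / (cH * n%:R) * m * t
    = 2 * eta + 2 * (c * m) * t); first exact: bernstein_tail.
  by rewrite etaE /c; field; rewrite (gt_eqF n0) (gt_eqF cH_gt0).
Qed.
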